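(* Let $G=(V,E)$ be a finite graph that is not connected, let $Q\in\mathbb{R}^V$, $H_Q=\Delta_G+Q$ and $T>0$. Then $H_Q$ fails to do phase retrieval: there exist $u_0,v_0\in\mathbb{C}^V$ with $|(e^{-itH_Q}u_0)(j)|=|(e^{-itH_Q}v_0)(j)|$ for all $t\in[0,T]$ and $j\in V$, but such that there is no $c\in\mathbb{C}$ with $|c|=1$ and $v_0=c\,u_0$.
   Context: $G=(V,E)$ is a finite simple undirected graph. Its combinatorial Laplacian is $\Delta_G u(j)=\sum_{k\sim j}(u(j)-u(k))$. A potential $Q\in\mathbb{R}^V$ is identified with the diagonal operator $(Qu)(j)=Q(j)u(j)$. *)

(* Defs.v *)
From HB Require Import structures.
From mathcomp Require Import all_boot all_order all_algebra.
From mathcomp Require Import complex.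
From mathcomp Require Import all_classical all_reals all_analysis.

Set Implicit Arguments.
Unset Strict Implicit.
Unset Printing Implicit Defensive.

Import Order.TTheory GRing.Theory Num.Theory numFieldNormedType.Exports.

Local Open Scope ring_scope.
Local Open Scope complex_scope.

Record sgraph := SGraph {
  vertex :> finType;
  adj : rel vertex;
  adj_sym : symmetric adj;
  adj_irr : irreflexive adj
}.

(* The graph without vertices counts as connected. *)
Definition connected_graph (G : sgraph) : Prop :=
  forall x y : G, connect (@adj G) x y.

(* [R[i]^o] is [R[i]] as a normed module over itself: this alias carries the
   topology in which limits of complex sequences are taken. *)
Definition laplacian (R : realType) (G : sgraph) (u : G -> R[i]^o) :
    G -> R[i]^o :=
  fun j => \sum_(k | adj j k) (u j - u k).

Definition hamiltonian (R : realType) (G : sgraph) (Q : G -> R)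
    (u : G -> R[i]^o) : G -> R[i]^o :=
  fun j => laplacian u j + (Q j)%:C * u j.

(* (e^A u)(j) = \sum_k (A^k u)(j) / k!; the series converges for every linear
   [A], see [is_cvg_exp_op]. *)
Definition exp_op (R : realType) (V : finType)
    (A : (V -> R[i]^o) -> (V -> R[i]^o)) (u : V -> R[i]^o) : V -> R[i]^o :=
  fun j => limn (series (fun k => (k`!%:R^-1 * iter k A u j : R[i]^o))).

(* e^{-itH} *)
Definition propagator (R : realType) (V : finType)
    (H : (V -> R[i]^o) -> (V -> R[i]^o)) (t : R) :
    (V -> R[i]^o) -> (V -> R[i]^o) :=
  exp_op (fun u j => - 'i%C * t%:C * H u j).


Lemma le_Re_normc (R : realType) (z : R[i]) : `|complex.Re z| <= Normc.normc z.
Proof.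
case: z => a b /=; rewrite -sqrtr_sqr ler_sqrt ?addr_ge0 ?sqr_ge0 //.
by rewrite lerDl sqr_ge0.
Qed.

Lemma le_Im_normc (R : realType) (z : R[i]) : `|complex.Im z| <= Normc.normc z.
Proof.
case: z => a b /=; rewrite -sqrtr_sqr ler_sqrt ?addr_ge0 ?sqr_ge0 //.
by rewrite lerDr sqr_ge0.
Qed.

Lemma normc_normE (R : realType) (z : R[i]) : `|z| = (Normc.normc z)%:C.
Proof. by case: z. Qed.

Lemma normc_sum (R : realType) (I : finType) (F : I -> R[i]) :
  Normc.normc (\sum_i F i) <= \sum_i Normc.normc (F i).
Proof.
by rewrite -lecR -normc_normE rmorph_sum /= (le_trans (ler_norm_sum _ _ _)) //.
Qed.

Lemma is_cvg_complex (R : realType) (f : nat -> R[i]^o) :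
  cvgn (fun n => complex.Re (f n) : R) -> cvgn (fun n => complex.Im (f n) : R) -> cvgn f.
Proof.
move=> /cvg_ex[a /cvgrPdist_lt fa] /cvg_ex[b /cvgrPdist_lt fb].
apply/cvg_ex; exists ((a +i* b) : R[i]^o); apply/cvgrPdist_lt => e.
rewrite ltcE /= => /andP[/eqP e' e0].
have e20 : 0 < complex.Re e / 2 by rewrite divr_gt0.
near=> n.
have Ha : `|a - complex.Re (f n)| < complex.Re e / 2 by near: n; exact: fa.
have Hb : `|b - complex.Im (f n)| < complex.Re e / 2 by near: n; exact: fb.
case: (f n) Ha Hb => x y /= Ha Hb.
have -> : (a +i* b) - (x +i* y) = (a - x)%:C + (0 +i* (b - y)) by simpc.
apply: (le_lt_trans (ler_normD _ _)).
rewrite !normc_normE /= !expr0n /= addr0 add0r !sqrtr_sqr.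
by rewrite -rmorphD ltcE /= e' eqxx /= [ltRHS]splitr ltrD.
Unshelve. all: by end_near. Qed.

(* The exponential series of a linear operator converges, so the limit in
   [exp_op] is not a default value. *)
Lemma is_cvg_exp_op (R : realType) (V : finType)
    (A : {linear (V -> R[i]^o) -> (V -> R[i]^o)}) (u : V -> R[i]^o) (j : V) :
  cvgn (series (fun k => (k`!%:R^-1 * iter k A u j : R[i]^o))).
Proof.
pose d (i : V) : V -> R[i]^o := fun k => (k == i)%:R.
pose s (v : V -> R[i]^o) : R := \sum_i Normc.normc (v i).
pose K := \sum_j \sum_i Normc.normc (A (d i) j).
have n0 (z : R[i]) : 0 <= Normc.normc z by case: z => a b; exact: sqrtr_ge0.
have s0 v : 0 <= s v by exact: sumr_ge0.
have K0 : 0 <= K by apply: sumr_ge0 => i _; apply: sumr_ge0.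
have sA v : s (A v) <= K * s v.
  have vE : v = \sum_i v i *: d i.
    apply/funext => k; rewrite fct_sumE (bigD1 k) //= big1 => [|i ik].
      by rewrite addr0 /d /GRing.scale /= /GRing.scale /= eqxx mulr1.
    by rewrite /d /GRing.scale /= /GRing.scale /= eq_sym (negbTE ik) mulr0.
  rewrite [in leLHS]vE linear_sum /= /K mulr_suml; apply: ler_sum => k _.
  rewrite fct_sumE; apply: (le_trans (normc_sum _)); rewrite mulr_suml.
  apply: ler_sum => i _.
  have -> : A (v i *: d i) k = v i * A (d i) k by rewrite linearZ.
  rewrite Normc.normcM mulrC ler_wpM2l // /s (bigD1 i) //= lerDl.
  exact: sumr_ge0.
have sk k : s (iter k A u) <= K ^+ k * s u.
  elim: k => [|k IH]; first by rewrite expr0 mul1r.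
  by rewrite iterS exprS -mulrA (le_trans (sA _)) // ler_wpM2l.
have bd k : Normc.normc (k`!%:R^-1 * iter k A u j) <= s u * exp_coeff K k.
  rewrite Normc.normcM Normc.normcV.
  have -> : Normc.normc (k`!%:R : R[i]) = k`!%:R.
    by apply: complexI; rewrite -normc_normE normr_nat rmorph_nat.
  rewrite [leRHS](_ : _ = k`!%:R^-1 * (K ^+ k * s u)); last first.
    by rewrite /exp_coeff /= mulrA [s u * _]mulrC [RHS]mulrC.
  rewrite ler_wpM2l ?invr_ge0 //.
  apply: (le_trans _ (sk k)); rewrite /s (bigD1 j) //= lerDl.
  exact: sumr_ge0.
have bc : cvgn (series (s u *: exp_coeff K)).
  exact: (@is_cvg_seriesZ R _ (s u) (is_cvg_series_exp_coeff K)).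
have cv (f : R[i] -> R) (a : nat -> R[i]) :
    (forall z, `|f z| <= Normc.normc z) ->
    (forall k, Normc.normc (a k) <= s u * exp_coeff K k) ->
    cvgn (series (fun k => f (a k))).
  move=> fn an; apply: normed_cvg; apply: series_le_cvg bc => [k|k|k] /=.
  - exact: normr_ge0.
  - exact: le_trans (an k).
  - exact: le_trans (fn _) (an k).
apply: is_cvg_complex.
- rewrite [X in cvgn X](_ : _ = series (fun k =>
      complex.Re (k`!%:R^-1 * iter k A u j))); first exact: cv (@le_Re_normc R) bd.
  apply/funext => n.
  by apply: (big_morph (@complex.Re R)) => // -[? ?] [? ?].
- rewrite [X in cvgn X](_ : _ = series (fun k =>
      complex.Im (k`!%:R^-1 * iter k A u j))); first exact: cv (@le_Im_normc R) bd.
  apply/funext => n.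
  by apply: (big_morph (@complex.Im R)) => // -[? ?] [? ?].
Qed.

(* Main.v *)
Require Import Defs.
From HB Require Import structures.
From mathcomp Require Import all_boot all_order all_algebra.
From mathcomp Require Import complex.
From mathcomp Require Import all_classical all_reals all_analysis.
Import Order.TTheory GRing.Theory Num.Theory numFieldNormedType.Exports.
Local Open Scope ring_scope.
Local Open Scope complex_scope.

(** The sign [s], equal to [1] on one connected component and to [-1] elsewhere,
    is constant along edges. Multiplication by [s] therefore commutes with [H_Q],
    hence with [e^{-itH_Q}], so that [1] and [s] evolve with equal moduli at every
    vertex, although [s] is not a multiple of [1]. *)

(** Every iterate of [A] commutes with multiplication by [s], so [s j] factors out of each partial
    sum of the exponential series at [j]. *)
Lemma exp_op_mul (R : realType) (V : finType)
    (A : {linear (V -> R[i]^o) -> (V -> R[i]^o)}) (s u : V -> R[i]^o) (j : V) :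
  (forall v, A (s * v) = s * A v) -> exp_op A (s * u) j = s j * exp_op A u j.
Proof.
move=> As; have iterA k : iter k A (s * u) = s * iter k A u.
  by elim: k => //= k ->.
(* Convergence is what lets the scalar [s j] pass through [limn], which is only a default value on a
   divergent sequence. *)
have /(cvgZl_tmp (k := s j)) := @is_cvg_exp_op R V A u j.
move=> /cvg_lim lim_sj; apply: etrans (lim_sj _) => //.
rewrite /exp_op; congr (limn _); apply/funext => n.
rewrite /series /= scaler_sumr; apply: eq_bigr => k _.
by rewrite iterA mulrCA.
Qed.

Lemma hamiltonian_linear (R : realType) (G : sgraph) (Q : G -> R) :
  linear (hamiltonian Q).
Proof.
move=> a u v; apply/funext => j.
rewrite /hamiltonian /laplacian !fctE /GRing.scale /=.
rewrite mulrDr mulrDr addrACA mulr_sumr -big_split /= (mulrCA _ a).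
congr (_ + _).
by apply: eq_bigr => k _; rewrite mulrBr opprD addrACA.
Qed.

(** The potential is itself a multiplication, and the Laplacian compares values only across edges,
    where [s j] and [s k] agree. *)
Lemma hamiltonian_mul (R : realType) (G : sgraph) (Q : G -> R)
    (s u : G -> R[i]^o) :
  (forall j k, adj j k -> s j = s k) ->
  hamiltonian Q (s * u) = s * hamiltonian Q u.
Proof.
move=> s_adj; apply/funext => j; rewrite /hamiltonian /laplacian !fctE.
rewrite mulrDr mulr_sumr mulrCA; congr (_ + _); apply: eq_bigr => k jk.
by rewrite -(s_adj j k jk) mulrBr.
Qed.

Lemma propagator_mul (R : realType) (G : sgraph) (Q : G -> R) (t : R)
    (s u : G -> R[i]^o) (j : G) :
  (forall j k, adj j k -> s j = s k) ->
  propagator (hamiltonian Q) t (s * u) j =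
  s j * propagator (hamiltonian Q) t u j.
Proof.
move=> s_adj; rewrite /propagator; set A := (X in exp_op X).
have A_linear : linear A.
  move=> a v w; apply/funext => k.
  by rewrite /A hamiltonian_linear !fctE /GRing.scale /= mulrDr mulrCA.
(* Bundling the generator as a linear map gives access to the convergence of its exponential
   series. *)
pose Alin := GRing.isLinear.Build _ _ _ _ A A_linear.
pose B : {linear _ -> _} := HB.pack A Alin.
apply: (@exp_op_mul R G B) => v; apply/funext => k.
by rewrite /= /A hamiltonian_mul // !fctE mulrCA.
Qed.

Theorem mainTheorem10 (R : realType) (G : sgraph) (Q : G -> R) (T : R)
    (G_disconnected : ~ connected_graph G) (T_gt0 : 0 < T) :
  exists u0 v0 : G -> R[i]^o,
    (forall (t : R) (j : G), 0 <= t <= T ->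
       `|propagator (hamiltonian Q) t u0 j| =
       `|propagator (hamiltonian Q) t v0 j|) /\
    ~ (exists c : R[i], `|c| = 1 /\ v0 = c *: u0).
Proof.
have [x [y nxy]] : exists x y : G, ~~ connect (@adj G) x y.
  apply: contrapT => h; apply: G_disconnected => x y; apply: contrapT => nxy.
  by apply: h; exists x, y; apply/negP.
pose s : G -> R[i]^o := fun j => (-1) ^+ ~~ connect (@adj G) x j.
have s_adj j k : adj j k -> s j = s k.
  move=> jk; congr (_ ^+ ~~ _).
  (* Adjacent vertices are reachable from the same vertices, [x] included. *)
  exact/same_connect1r/jk/sym_connect_sym/adj_sym.
(* Here [1] is the constant function, so [s = s * 1] and the two evolutions differ at [j] by the
   factor [s j] of modulus 1. *)
exists 1, s; split=> [t j _|[c [_ sE]]].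
  by rewrite -[in RHS](mulr1 s) propagator_mul // normrM normrX normrN1 expr1n mul1r.
(* A multiple of the constant function is constant, but [s] takes the values [1] at [x] and [-1] at
   [y]. *)
have sc j : s j = c by rewrite sE; exact: mulr1.
have : s x = s y by rewrite !sc.
rewrite /s connect0 nxy expr0 expr1 => /eqP.
by rewrite -subr_eq0 opprK -(natrD _ 1 1) pnatr_eq0.
Qed.
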